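(* Every rooted-tree SEFE problem $(T,(G_t\mid t\in V(T)))$ can be reduced to a simultaneous embedding problem all of whose graphs are in $(G_t\mid t\in V(T))$: there is a temporal sequence, each of whose graphs is one of the graphs $G_t$ with $t\in V(T)$, that is simultaneously embeddable if and only if the rooted-tree SEFE problem $(T,(G_t\mid t\in V(T)))$ is satisfiable.
   Context: An instance of the rooted-tree SEFE problem is a finite rooted tree $T$ with a graph $G_t$ assigned to each node $t$ such that for every edge $vw$ of $T$ with $v$ nearer to the root than $w$, $G_v$ is a subgraph of $G_w$ (edges and vertices being labelled). It is satisfiable if there are planar embeddings of all the $G_t$ such that for each such edge $vw$ the embedding of $G_w$ induces the embedding of $G_v$. A minor $H\preceq G$ comes with fixed sets of edges to be deleted and contracted; edge labels are kept. A temporal sequence is a sequence $(G_1,\dots,G_n)$ of graphs such that for each $i\in[n-1]$ either $G_i\preceq G_{i+1}$ or $G_{i+1}\preceq G_i$; here the minor relations are the given subgraph inclusions. It is simultaneously embeddable if there are planar embeddings $\iota_i$ of $G_i$ such that for consecutive $i,j$ with $G_i\preceq G_j$, $\iota_i$ is the embedding obtained from $\iota_j$ by applying the minor operations. *)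

(* Defs.v *)
From HB Require Import structures.
From mathcomp Require Import all_boot all_order all_algebra.
From mathcomp Require Import all_classical all_reals all_analysis.
Set Implicit Arguments.
Unset Strict Implicit.
Unset Printing Implicit Defensive.
Import Order.TTheory GRing.Theory Num.Theory.
Import numFieldNormedType.Exports.
Local Open Scope classical_set_scope.
Local Open Scope ring_scope.

(* Finite graphs whose vertices and edges carry labels in V and E.  Loops
   (one end) and parallel edges are allowed; [ends a] is irrelevant when
   [a] is not an edge of the graph. *)
Record lgraph (V E : finType) := LGraph {
  vset : {set V};
  eset : {set E};
  ends : E -> {set V};
  ends_vset : forall a, a \in eset -> ends a \subset vset;
  ends_card : forall a, a \in eset -> (0 < #|ends a| <= 2)%N
}.

(* Inclusion of labelled graphs; a minor relation that contracts no edge. *)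
Definition subgraph (V E : finType) (H G : lgraph V E) : Prop :=
  [/\ vset H \subset vset G, eset H \subset eset G
    & forall a, a \in eset H -> ends H a = ends G a].

(* Only the values on the vertices and edges of the drawn graph matter.  An
   edge is drawn as the set of points of its curve, both ends included. *)
Record drawing (R : realType) (V E : finType) := Drawing {
  vpoint : V -> R * R;
  ecurve : E -> set (R * R)
}.

(* [C] is a simple arc, or a simple closed curve when its two endpoints
   agree, and [P] is the set of its endpoints. *)
Definition simple_curve (R : realType) (C P : set (R * R)) : Prop :=
  exists gamma : R -> R * R,
    [/\ {within `[0, 1], continuous gamma},
        set_inj `[0, 1[ gamma, set_inj `]0, 1] gamma,
        gamma @` `[0, 1] = C
      & [set gamma 0; gamma 1] = P].

Definition planar_embedding (R : realType) (V E : finType)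
    (G : lgraph V E) (d : drawing R V E) : Prop :=
  [/\ {in vset G &, injective (vpoint d)},
      forall a, a \in eset G ->
        simple_curve (ecurve d a) (vpoint d @` [set` ends G a]),
      forall v a, v \in vset G -> a \in eset G ->
        ecurve d a (vpoint d v) -> v \in ends G a
    & forall a b, a \in eset G -> b \in eset G -> a != b ->
        ecurve d a `&` ecurve d b
          `<=` vpoint d @` [set` (ends G a :&: ends G b)%SET]].

(* For [H] a subgraph of the graph drawn by [d], the restriction of [d] to
   [H] is [d'], as drawings of [H]. *)
Definition induces (R : realType) (V E : finType) (H : lgraph V E)
    (d d' : drawing R V E) : Prop :=
  {in vset H, vpoint d =1 vpoint d'} /\ {in eset H, ecurve d =1 ecurve d'}.

(* Symmetry makes every edge a cycle of length two, hence the bound. *)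
Definition is_tree (T : finType) (adj : rel T) : Prop :=
  [/\ symmetric adj, irreflexive adj, forall x y, connect adj x y
    & forall c : seq T, ucycle adj c -> (size c <= 2)%N].

(* The distance from r to v is smaller than the distance from r to w. *)
Definition nearer (T : finType) (adj : rel T) (r v w : T) : Prop :=
  exists p : seq T, [/\ path adj r p, last r p = v
    & forall q : seq T, path adj r q -> last r q = w -> (size p < size q)%N].

Definition rooted_tree_sefe (V E T : finType) (adj : rel T) (r : T)
    (G : T -> lgraph V E) : Prop :=
  is_tree adj /\
  forall v w, adj v w -> nearer adj r v w -> subgraph (G v) (G w).

Definition satisfiable (R : realType) (V E T : finType) (adj : rel T) (r : T)
    (G : T -> lgraph V E) : Prop :=
  exists iota : T -> drawing R V E,
    (forall t, planar_embedding (G t) (iota t)) /\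
    (forall v w, adj v w -> nearer adj r v w ->
       induces (G v) (iota w) (iota v)).

(* Temporal sequences all of whose minor relations are subgraph inclusions. *)
Definition temporal_sequence (V E : finType) (n : nat)
    (H : 'I_n -> lgraph V E) : Prop :=
  forall i j : 'I_n, j = i.+1 :> nat ->
    subgraph (H i) (H j) \/ subgraph (H j) (H i).

Definition simultaneously_embeddable (R : realType) (V E : finType) (n : nat)
    (H : 'I_n -> lgraph V E) : Prop :=
  exists iota : 'I_n -> drawing R V E,
    (forall i, planar_embedding (H i) (iota i)) /\
    (forall i j : 'I_n, j = i.+1 :> nat \/ i = j.+1 :> nat ->
       subgraph (H i) (H j) -> induces (H i) (iota j) (iota i)).

(* Main.v *)
Require Import Defs.
From mathcomp Require Import all_boot all_order all_algebra.
From mathcomp Require Import all_classical all_reals all_analysis.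
(** The temporal sequence lists the graphs met by a closed walk around the tree
    that starts at the root and, after each excursion into the branch at a
    child, comes back to the parent.  A solution of the tree problem restricts
    to this walk at once, since consecutive nodes are adjacent in the tree.

    The converse has to merge the drawings that several visits to one node
    receive.  Two consecutive visits to [u] are separated by an excursion that
    enters and leaves the branch at a child [w] through [w], and [G u] is a
    subgraph of [G w].  If all visits to [w] draw [G w] alike, then both visits
    to [u] draw [G u] as the restriction of that drawing, hence alike.  So each
    node has one well-defined drawing, and the step of the walk along an edge
    of the tree gives the compatibility required on that edge.

    Such walks are generated here by insertion ([tour]): replace a visit to [u]
    by [u, w, u], where [w] is a child of [u] not visited before.  The argument
    above then becomes an induction ([tour_glue]) in which the inserted node
    occurs exactly once, so that its drawing is not in question, and the two
    copies of [u] around it agree and collapse to one.  Insertion reaches every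
    node ([exists_full_tour]), and as parents are unique ([parent_uniq]) every
    edge of the tree is the edge of some insertion.

    The tree is given by the absence of long cycles, and its orientation by
    distances to the root.  The two facts needed about it, that adjacent nodes
    differ in depth and that parents are unique, both follow from
    [level_path_nil]. *)

Set Implicit Arguments.
Unset Strict Implicit.
Unset Printing Implicit Defensive.

(** * Drawings that agree on a graph *)

Lemma induces_sym (R : realType) (V E : finType) (H : lgraph V E)
    (d d' : drawing R V E) : induces H d d' -> induces H d' d.
Proof. by case=> hv he; split=> x hx; rewrite ?hv ?he. Qed.

Lemma induces_trans (R : realType) (V E : finType) (H : lgraph V E)
    (d1 d2 d3 : drawing R V E) :
  induces H d1 d2 -> induces H d2 d3 -> induces H d1 d3.
Proof.
by case=> hv he [hv' he']; split=> x hx; rewrite ?hv ?he // ?hv' ?he'.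
Qed.

Lemma induces_subgraph (R : realType) (V E : finType) (H K : lgraph V E)
    (d d' : drawing R V E) : subgraph H K -> induces K d d' -> induces H d d'.
Proof.
case=> /fintype.subsetP sv /fintype.subsetP se _ [hv he].
by split=> x hx; rewrite ?hv ?he ?sv ?se.
Qed.

Lemma planar_embedding_induces (R : realType) (V E : finType)
    (H : lgraph V E) (d d' : drawing R V E) :
  induces H d d' -> planar_embedding H d -> planar_embedding H d'.
Proof.
move=> [hv he] [inj curve avoid cross].
have im (A : {set V}) : A \subset vset H ->
    (vpoint d @` [set` A] = vpoint d' @` [set` A])%classic.
  move=> /fintype.subsetP sA; apply: eq_imagel => x /= xA.
  exact/hv/sA.
split=> [v w hv1 hw1|a ha|v a hv1 ha|a b ha hb ab].
- by rewrite -!hv //; apply: inj.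
- by rewrite -he // -im ?ends_vset //; apply: curve.
- by rewrite -he // -hv //; apply: avoid.
- rewrite -!he // -im; first exact: cross.
  exact: fintype.subset_trans (finset.subsetIl _ _) (ends_vset ha).
Qed.

(** * Depth in a rooted tree *)

(** The two parts say that the value is attained by a walk from the root and
    that no walk is shorter, which makes [d] the distance to [r]. *)
Definition is_depth (T : finType) (adj : rel T) (r : T) (d : T -> nat) : Prop :=
  forall x,
    (exists p, [/\ path adj r p, last r p = x & size p = d x]) /\
    (forall p, path adj r p -> last r p = x -> d x <= size p).

Lemma exists_depth (T : finType) (adj : rel T) (r : T) :
  (forall x, connect adj r x) -> exists d, is_depth adj r d.
Proof.
move=> conn.
pose attains x n := `[<exists p, [/\ path adj r p, last r p = x & size p = n]>].
have attained x : exists n, attains x n.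
  have /connectP[p rp xp] := conn x.
  by exists (size p); apply/asboolP; exists p.
exists (fun x => ex_minn (attained x)) => x.
case: ex_minnP => n /asboolP hn minn; split=> // p rp xp.
by apply: minn; apply/asboolP; exists p.
Qed.

Section Depth.
Variables (T : finType) (adj : rel T) (r : T) (d : T -> nat).
Hypothesis depth_d : is_depth adj r d.

Lemma depth_step x y : adj x y -> d y <= (d x).+1.
Proof.
move=> xy; have [[p [rp xp <-]] _] := depth_d x.
have [_ min_y] := depth_d y; rewrite -(size_rcons p y); apply: min_y.
  by rewrite rcons_path rp xp.
by rewrite last_rcons.
Qed.

Lemma depth_eq0 x : d x = 0 -> x = r.
Proof.
move=> dx; have [[p [_ xp szp]] _] := depth_d x.
by move: szp; rewrite dx -xp => /size0nil ->.
Qed.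

Lemma depth_pred x k : d x = k.+1 -> exists2 y, adj y x & d y = k.
Proof.
move=> dx; have [[p [rp xp szp]] _] := depth_d x; rewrite dx in szp.
case/lastP: p => [//|p z] in rp xp szp *.
move: rp xp szp; rewrite rcons_path last_rcons size_rcons => /andP[rp yz] zx [szp].
rewrite {}zx in yz; exists (last r p) => //; apply/eqP; rewrite eqn_leq.
have [_ min_y] := depth_d (last r p).
by rewrite -{1}szp min_y //= -ltnS -dx depth_step.
Qed.

Lemma nearer_depth v w : nearer adj r v w <-> d v < d w.
Proof.
have [[pv [rpv epv szv]] minv] := depth_d v.
have [[pw [rpw epw szw]] minw] := depth_d w.
split=> [[p [rp ep shorter]]|vw].
  by rewrite -szw; apply: leq_ltn_trans (minv _ rp ep) (shorter _ rpw epw).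
by exists pv; split=> // q rq eq; rewrite szv; apply: leq_trans vw (minw _ rq eq).
Qed.

Hypothesis tree : is_tree adj.

(** Otherwise the two ends of the path are distinct.  If they have a common
    neighbour one level up, it closes the path to a cycle; if not, prolonging
    the path at both ends by neighbours one level up gives a longer path of the
    same kind, nearer to the root.  At the root both ends would coincide. *)
Lemma level_path_nil k x p :
  d x = k -> d (last x p) = k -> all (fun z => k <= d z) p ->
  path adj x p -> uniq (x :: p) -> p = [::].
Proof.
case: tree => sym _ _ acyclic.
elim: k x p => [|k IH] x p dx dl above xp; first case: p => // y q in dl above xp *.
  have lx : last y q = x by rewrite (depth_eq0 dx) -(depth_eq0 dl).
  by rewrite cons_uniq -{1}lx mem_last.
have [x' xx' dx'] := depth_pred dx; have [l' ll' dl'] := depth_pred dl.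
have low z : d z = k -> z \notin x :: p.
  move=> dz; apply/negP; rewrite inE => /predU1P[zx|zp].
    by have := ltnSn k; rewrite -{2}dx -zx dz ltnn.
  by have := allP above _ zp; rewrite dz ltnn.
move=> un; have [x'l'|x'l'] := eqVneq x' l'.
  suff /acyclic : ucycle adj (x' :: x :: p) by case: (p).
  by rewrite /ucycle cons_uniq un low //= rcons_path xx' xp x'l' sym ll'.
(* Everything on the old path is at depth [k.+1] or more, so the two new ends
   at depth [k] are not on it. *)
suff : rcons (x :: p) l' = [::] by case: (p).
apply: (IH x') => //; rewrite ?last_rcons //.
- rewrite all_rcons dl' leqnn /= dx leqnSn /=.
  by apply: sub_all above => z /ltnW.
- by rewrite rcons_path /= xx' xp sym.
- rewrite cons_uniq mem_rcons [_ \in _ :: _]inE negb_or x'l' low // rcons_uniq.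
  by rewrite low.
Qed.

(** An edge inside a level would be a path excluded by [level_path_nil]. *)
Lemma depth_neq x y : adj x y -> d x != d y.
Proof.
case: (tree) => _ irr _ _ xy; apply/eqP => dxy.
suff: [:: y] = [::] by [].
apply: (@level_path_nil (d x) x) => //=; rewrite ?dxy ?leqnn ?xy //.
by rewrite inE andbT; apply: contraTneq xy => ->; rewrite irr.
Qed.

(** Two neighbours [u], [v] of [w] above [w] lie on one level, and the path
    [u, w, v] is excluded by [level_path_nil]. *)
Lemma depth_parent_uniq u v w :
  adj u w -> adj v w -> d u < d w -> d v < d w -> u = v.
Proof.
case: (tree) => sym irr _ _ uw vw duw dvw.
have du : d w = (d u).+1 by apply/eqP; rewrite eqn_leq depth_step.
have dv : d w = (d v).+1 by apply/eqP; rewrite eqn_leq depth_step.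
apply/eqP; apply: contraT => neq.
suff: [:: w; v] = [::] by [].
apply: (@level_path_nil (d u) u) => //=.
- by case: du; rewrite dv => -[].
- by rewrite (ltnW duw) -ltnS -du dv leqnn.
- by rewrite uw sym vw.
rewrite !inE negb_or neq !andbT.
by apply/andP; split; [apply: contraTneq uw|apply: contraTneq vw] => ->; rewrite irr.
Qed.

End Depth.

Definition parent (T : finType) (adj : rel T) (r u w : T) : Prop :=
  adj u w /\ nearer adj r u w.

Lemma adj_parent (T : finType) (adj : rel T) (r u w : T) :
  is_tree adj -> adj u w -> parent adj r u w \/ parent adj r w u.
Proof.
move=> tree uw; case: (tree) => sym _ conn _.
have [d hd] := exists_depth (conn r).
rewrite /parent !(nearer_depth hd) (sym w u).
by case: ltngtP (depth_neq hd tree uw) => //; [left|right].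
Qed.

Lemma parent_uniq (T : finType) (adj : rel T) (r u v w : T) :
  is_tree adj -> parent adj r u w -> parent adj r v w -> u = v.
Proof.
move=> tree [uw nuw] [vw nvw]; case: (tree) => _ _ conn _.
have [d hd] := exists_depth (conn r).
by apply: (depth_parent_uniq hd tree uw vw); apply/(nearer_depth hd).
Qed.

Lemma parent_neq_root (T : finType) (adj : rel T) (r u w : T) :
  parent adj r u w -> w != r.
Proof.
by move=> [_ [p [_ _ short]]]; apply/eqP => wr; have := short [::] isT (esym wr).
Qed.

(** * Tours of a rooted tree *)

(** These are the depth-first closed walks of the subtrees that contain the
    root.  Growing them by insertion at an arbitrary visit, rather than by
    concatenating the tours of the branches, makes the inserted node new to the
    whole walk, which is what the induction in [tour_glue] uses. *)
Inductive tour (T : finType) (adj : rel T) (r : T) : seq T -> Prop :=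
| tour_root : tour adj r [:: r]
| tour_insert s1 u w s2 of tour adj r (s1 ++ u :: s2) & parent adj r u w
    & w \notin s1 ++ u :: s2 : tour adj r (s1 ++ u :: w :: u :: s2).

Lemma tour_walk (T : finType) (adj : rel T) (r : T) (s : seq T) :
  symmetric adj -> tour adj r s -> sorted adj s.
Proof.
move=> sym; elim=> // s1 u w s2 _ walk [uw _] _.
by move: walk; rewrite !sorted_cat_cons /= uw sym uw.
Qed.

Lemma root_in_tour (T : finType) (adj : rel T) (r : T) (s : seq T) :
  tour adj r s -> r \in s.
Proof.
elim=> [|s1 u w s2 _ rs _ _]; first exact: mem_head.
by move: rs; rewrite !mem_cat !inE => /or3P[] ->; rewrite ?orbT.
Qed.

(** Induction on the depth of [x]: first reach its parent, then insert [x]. *)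
Lemma tour_extend (T : finType) (adj : rel T) (r : T) (s : seq T) (x : T) :
  is_tree adj -> tour adj r s ->
  exists s', [/\ tour adj r s', {subset s <= s'} & x \in s'].
Proof.
move=> [_ _ conn _] ts; have [d hd] := exists_depth (conn r).
move: {2}(d x) (erefl (d x)) => k; elim: k x => [|k IH] x dx.
  by exists s; split=> //; rewrite (depth_eq0 hd dx); apply: root_in_tour ts.
have [y yx dy] := depth_pred hd dx; have [s' [ts' ss' ys']] := IH y dy.
have [xs'|xs'] := boolP (x \in s'); first by exists s'.
case/splitPr: ys' => s1 s2 in ts' ss' xs' *.
exists (s1 ++ y :: x :: y :: s2); split.
- by apply: tour_insert => //; split=> //; apply/(nearer_depth hd); rewrite dx dy.
- move=> z /ss'; rewrite !mem_cat !inE => /or3P[] ->; rewrite ?orbT //.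
- by rewrite mem_cat !inE eqxx !orbT.
Qed.

Lemma exists_full_tour (T : finType) (adj : rel T) (r : T) :
  is_tree adj -> exists2 s, tour adj r s & forall x, x \in s.
Proof.
move=> tree.
suff [s ts full] : exists2 s, tour adj r s & {subset enum T <= s}.
  by exists s => // x; rewrite full ?mem_enum.
elim: (enum T) => [|x l [s ts sub]]; first by exists [:: r]; [exact: tour_root|].
have [s' [ts' ss' xs']] := tour_extend x tree ts.
by exists s' => // y; rewrite inE => /predU1P[->|/sub/ss'].
Qed.

(** * Gluing the drawings along a tour *)

(** The condition that simultaneous embeddability puts on consecutive members,
    for a sequence whose members are nodes paired with drawings. *)
Definition compatible (R : realType) (V E T : finType) (G : T -> lgraph V E)
    (a b : T * drawing R V E) : bool :=
  `[< (subgraph (G a.1) (G b.1) -> induces (G a.1) b.2 a.2) /\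
      (subgraph (G b.1) (G a.1) -> induces (G b.1) a.2 b.2) >].

(** Compatibility reads only the part of a drawing that belongs to its graph;
    this lets one copy of a node take the place of another in a sequence. *)
Lemma compatible_replace (R : realType) (V E T : finType) (G : T -> lgraph V E)
    (u : T) (d d' : drawing R V E) (b : T * drawing R V E) :
  induces (G u) d d' -> compatible G (u, d) b -> compatible G (u, d') b.
Proof.
move=> dd' /asboolP[ub bu]; apply/asboolP; split=> /= sub.
  exact: induces_trans (ub sub) dd'.
apply: induces_trans (bu sub).
exact/(induces_subgraph sub)/induces_sym.
Qed.

Definition follows (R : realType) (V E T : finType) (G : T -> lgraph V E)
    (f : T -> drawing R V E) (a : T * drawing R V E) : bool :=
  `[< induces (G a.1) a.2 (f a.1) >].

Lemma follows_update (R : realType) (V E T : finType) (G : T -> lgraph V E)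
    (f : T -> drawing R V E) (w : T) (d : drawing R V E)
    (L : seq (T * drawing R V E)) :
  w \notin [seq a.1 | a <- L] -> all (follows G f) L ->
  all (follows G (fun t => if t == w then d else f t)) L.
Proof.
elim: L => //= a L IH; rewrite inE negb_or => /andP[wa wL] /andP[fa fL].
by rewrite IH // andbT /follows eq_sym (negPf wa).
Qed.

Lemma map_eq_cat (A B : Type) (f : A -> B) (L : seq A) (s1 s2 : seq B) :
  map f L = s1 ++ s2 ->
  exists L1 L2, [/\ L = L1 ++ L2, map f L1 = s1 & map f L2 = s2].
Proof.
move=> eL; exists (take (size s1) L), (drop (size s1) L).
by rewrite cat_take_drop map_take map_drop eL take_size_cat ?drop_size_cat.
Qed.

(** Induction on the tour.  Around the inserted visit to [w] the graph [G u] is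
    contained in [G w], so the two visits to [u] restrict the same drawing of
    [G w] and agree.  Dropping [w] and one copy of [u] therefore leaves a
    compatible sequence, whose glued family [f] extends by the drawing of [w].
    The second conclusion records the edge of each insertion. *)
Lemma tour_glue (R : realType) (V E T : finType) (adj : rel T) (r : T)
    (G : T -> lgraph V E) (L : seq (T * drawing R V E)) :
  (forall u w, parent adj r u w -> subgraph (G u) (G w)) ->
  tour adj r [seq a.1 | a <- L] -> sorted (compatible G) L ->
  exists2 f : T -> drawing R V E, all (follows G f) L &
    forall w, w \in [seq a.1 | a <- L] -> w != r ->
      exists u, [/\ u \in [seq a.1 | a <- L], parent adj r u w
                  & induces (G u) (f w) (f u)].
Proof.
move=> subG; move eL: [seq a.1 | a <- L] => s ts.
elim: ts L eL => {s} [|s1 u w s2 _ IH uw ws] L eL chain.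
  case: L eL chain => [//|[t d] [|//]] [->] _.
  exists (fun _ => d) => [|w]; first by rewrite /= andbT; apply/asboolP.
  by rewrite inE => ->.
have [L1 [L' [eLL' e1 e']]] := map_eq_cat eL; rewrite {}eLL' {L eL} in chain *.
case: L' e' chain => [//|[u0 d0] [//|[w1 d1] [//|[u2 d2] L2]]] /=.
move=> [-> -> -> e2] chain.
move: chain; rewrite !sorted_cat_cons /= => /and4P[chain1 c01 c12 chain2].
have d01 : induces (G u) d0 d1.
  by apply: induces_sym; case/asboolP: c01 => /(_ (subG _ _ uw)).
have d12 : induces (G u) d1 d2.
  by case/asboolP: c12 => _ /(_ (subG _ _ uw)).
have d20 : induces (G u) d2 d0 by apply/induces_sym/(induces_trans d01).
have [||f ff fpar] := IH (L1 ++ (u, d0) :: L2).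
- by rewrite map_cat /= e1 e2.
- rewrite sorted_cat_cons chain1 /=.
  case: L2 {e2} chain2 => //= b L2 /andP[+ ->].
  by rewrite andbT => /(compatible_replace d20).
move: ff; rewrite all_cat /= => /and3P[f1 /asboolP /= fu f2].
move: (ws); rewrite mem_cat inE !negb_or => /and3P[w1s wu w2s].
exists (fun t => if t == w then d1 else f t).
  rewrite all_cat /= !follows_update ?e1 ?e2 //= andbT.
  rewrite /follows /= eqxx eq_sym (negPf wu).
  apply/and3P; split; apply/asboolP => //.
  exact: induces_trans d20 fu.
have sub x : x \in s1 ++ u :: s2 -> x \in s1 ++ u :: w :: u :: s2.
  by rewrite !mem_cat !inE => /or3P[] ->; rewrite ?orbT.
move=> x; have [-> _ _|xw] := eqVneq x w.
  exists u; rewrite [u == w]eq_sym (negPf wu); split=> //.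
    by rewrite mem_cat mem_head orbT.
  exact: induces_trans (induces_sym d01) fu.
(* The edges recorded earlier end in nodes other than [w], so the new value at
   [w] leaves them untouched. *)
move=> xs xr; have [|v [vs vx fv]] := fpar x _ xr.
  by move: xs; rewrite !mem_cat !inE (negPf xw) /= => /or4P[] ->; rewrite ?orbT.
exists v; rewrite ifN; last by apply: contraNneq ws => <-.
by split=> //; apply: sub.
Qed.

Theorem lemma8p1 (R : realType) (V E T : finType) (adj : rel T) (r : T)
    (G : T -> lgraph V E) (hG : rooted_tree_sefe adj r G) :
  exists (n : nat) (s : 'I_n.+1 -> T),
    [/\ forall i j : 'I_n.+1, j = i.+1 :> nat -> adj (s i) (s j),
        temporal_sequence (fun i => G (s i))
      & simultaneously_embeddable R (fun i => G (s i)) <->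
        satisfiable R adj r G].
Proof.
case: hG => tree subG; case: (tree) => sym _ _ _.
have subP u w : parent adj r u w -> subgraph (G u) (G w).
  by case; apply: subG.
have [l tl full] := exists_full_tour r tree.
have walk := tour_walk sym tl.
(* The root makes the walk nonempty, so its length is a successor. *)
have [n szl] : exists n, size l = n.+1.
  by have := root_in_tour tl; case: (l) => // x l' _; exists (size l').
pose s (i : 'I_n.+1) := nth r l i.
have step (i j : 'I_n.+1) : j = i.+1 :> nat -> adj (s i) (s j).
  move=> ij; rewrite /s ij; apply/(sortedP r walk).
  by rewrite szl -ij.
exists n, s; split=> //.
  by move=> i j /step /(adj_parent r tree)[] /subP; [left|right].
split=> [[iota [planar compat]]|[iota [planar compat]]]; last first.
  exists (fun i => iota (s i)); split=> // i j ij sij.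
  have {ij} aij : adj (s i) (s j).
    by case: ij => /step //; rewrite sym.
  case: (adj_parent r tree aij) => [[_ nij]|pji]; first exact: compat.
  (* [s j] is the parent, so the two graphs contain each other and the tree
     condition has to be read from the other side. *)
  apply: (induces_subgraph sij); apply: induces_sym.
  by case: pji; apply: compat.
pose L := mkseq (fun i => (nth r l i, iota (inord i))) (size l).
have eL : [seq a.1 | a <- L] = l by rewrite -map_comp; exact: mkseq_nth.
have [f fL fpar] : exists2 f : T -> drawing R V E, all (follows G f) L &
    forall w, w \in l -> w != r ->
      exists u, [/\ u \in l, parent adj r u w & induces (G u) (f w) (f u)].
  rewrite -eL; apply: tour_glue => //; first by rewrite eL.
  apply/(sortedP (r, iota ord0)) => i; rewrite size_mkseq => il.
  rewrite !nth_mkseq // 1?ltnW //.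
  have [vi vj] : (inord i : 'I_n.+1) = i :> nat /\
      (inord i.+1 : 'I_n.+1) = i.+1 :> nat.
    by split; apply: inordK; rewrite -szl // ltnW.
  have := compat (inord i) (inord i.+1); have := compat (inord i.+1) (inord i).
  rewrite /s vi vj => ji ij; apply/asboolP; split=> /=.
    by apply: ij; left.
  by apply: ji; right.
exists f; split=> [t|v w vw nvw]; last first.
  have pvw : parent adj r v w by [].
  have [u [_ uw fuw]] := fpar w (full w) (parent_neq_root pvw).
  by rewrite (parent_uniq tree pvw uw).
have it : index t l < size l by rewrite index_mem.
move/(all_nthP (r, iota ord0)): fL => /(_ (index t l)).
rewrite size_mkseq nth_mkseq // => /(_ it)/asboolP /=.
rewrite nth_index // => ft; apply: (planar_embedding_induces ft).
have := planar (inord (index t l)).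
by rewrite /s inordK -?szl // nth_index.
Qed.
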